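(* Let $(L,\cdot,\circ)$ be a Novikov-Poisson algebra. Define $$[x,y]=x\circ y-y\circ x,\quad\forall x,y\in L.$$ Then $(L,\cdot,[\;,\;])$ is a transposed Poisson algebra.
   Context: All vector spaces are over a field $K$ of characteristic zero. Commutative associative algebras are not assumed unital. A Novikov-Poisson algebra is a triple $(L,\cdot,\circ)$, where $L$ is a vector space and $\cdot,\circ$ are bilinear operations on $L$ such that: (1) $(L,\cdot)$ is a commutative associative algebra; (2) $(L,\circ)$ is a Novikov algebra, i.e. $(x\circ y)\circ z-(y\circ x)\circ z=x\circ(y\circ z)-y\circ(x\circ z)$ and $(x\circ y)\circ z=(x\circ z)\circ y$ for all $x,y,z\in L$; (3) for all $x,y,z\in L$, $(x\cdot y)\circ z=x\cdot(y\circ z)$ and $(x\circ y)\cdot z-(y\circ x)\cdot z=x\circ(y\cdot z)-y\circ(x\cdot z)$. A transposed Poisson algebra is a triple $(L,\cdot,[\;,\;])$ where $(L,\cdot)$ is a commutative associative algebra, $(L,[\;,\;])$ is a Lie algebra, and $2z\cdot[x,y]=[z\cdot x,y]+[x,z\cdot y]$ for all $x,y,z\in L$. *)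

(* Defs.v *)
From mathcomp Require Import all_boot all_algebra.

Set Implicit Arguments.
Unset Strict Implicit.
Unset Printing Implicit Defensive.

Import GRing.Theory.
Local Open Scope ring_scope.

Section Algebras.
Variables (K : fieldType) (L : lmodType K).

(* The multiplications are bare operations on the vector space [L] rather than
   a ring structure, so that no unit is imposed. *)
Implicit Types mul circ br : L -> L -> L.

Definition bilinear_op (op : L -> L -> L) : Prop := bilinear_for *:%R *:%R op.

Record is_comm_assoc_algebra mul : Prop := CommAssocAlgebra {
  comm_assoc_bilinear : bilinear_op mul;
  comm_assoc_comm : commutative mul;
  comm_assoc_assoc : associative mul
}.

Record is_novikov_algebra circ : Prop := NovikovAlgebra {
  novikov_bilinear : bilinear_op circ;
  novikov_left_symmetric : forall x y z,
    circ (circ x y) z - circ (circ y x) z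
    = circ x (circ y z) - circ y (circ x z);
  novikov_right_commutative : forall x y z,
    circ (circ x y) z = circ (circ x z) y
}.

Record is_novikov_poisson_algebra mul circ : Prop := NovikovPoissonAlgebra {
  novikov_poisson_mul : is_comm_assoc_algebra mul;
  novikov_poisson_circ : is_novikov_algebra circ;
  novikov_poisson_mul_circ : forall x y z,
    circ (mul x y) z = mul x (circ y z);
  novikov_poisson_compat : forall x y z,
    mul (circ x y) z - mul (circ y x) z
    = circ x (mul y z) - circ y (mul x z)
}.

Record is_lie_algebra br : Prop := LieAlgebra {
  lie_bilinear : bilinear_op br;
  lie_alternating : forall x, br x x = 0;
  lie_jacobi : forall x y z,
    br x (br y z) + br y (br z x) + br z (br x y) = 0
}.

Record is_transposed_poisson_algebra mul br : Prop :=
  TransposedPoissonAlgebra {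
  transposed_poisson_mul : is_comm_assoc_algebra mul;
  transposed_poisson_lie : is_lie_algebra br;
  transposed_poisson_leibniz : forall x y z,
    2 *: mul z (br x y) = br (mul z x) y + br x (mul z y)
}.

Definition commutator_bracket circ : L -> L -> L :=
  fun x y => circ x y - circ y x.

End Algebras.

(* Main.v *)
Require Import Defs.
From mathcomp Require Import all_boot all_algebra.

(** The commutator bracket of any left-symmetric algebra is a Lie bracket: left
    symmetry turns [[x, [y, z]]] into the combination of right-nested products
    of [novikov_commutatorE], whose cyclic sum telescopes.  For the transposed
    Leibniz rule, the four terms of [[zx, y] + [x, zy]] split in two pairs:
    [(zx) o y - (zy) o x] is [z [x, y]] because the product can be pulled out
    of the left argument of the Novikov operation, and [x o (zy) - y o (zx)] is
    again [z [x, y]] by the other Novikov-Poisson compatibility. *)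

Import GRing.Theory.
Local Open Scope ring_scope.

Lemma bilinear_opBl (K : fieldType) (L : lmodType K) (op : L -> L -> L) :
  bilinear_op op -> forall x y z, op (x - y) z = op x z - op y z.
Proof.
case=> linl _ x y z.
by rewrite addrC -scaleN1r [LHS](linl z (-1) y x) /= scaleN1r addrC.
Qed.

Lemma bilinear_opBr (K : fieldType) (L : lmodType K) (op : L -> L -> L) :
  bilinear_op op -> forall x y z, op x (y - z) = op x y - op x z.
Proof.
case=> _ linr x y z.
by rewrite addrC -scaleN1r [LHS](linr x (-1) z y) /= scaleN1r addrC.
Qed.

Lemma commutator_bilinear (K : fieldType) (L : lmodType K)
    (circ : L -> L -> L) :
  bilinear_op circ -> bilinear_op (commutator_bracket circ).
Proof.
case=> linl linr; rewrite /commutator_bracket; split=> [z a x y|z a x y] /=;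
  by rewrite linl linr scalerBr opprD addrACA.
Qed.

Lemma novikov_commutatorE (K : fieldType) (L : lmodType K)
    (circ : L -> L -> L) : is_novikov_algebra circ ->
  forall x y z,
    commutator_bracket circ x (commutator_bracket circ y z)
    = (circ x (circ y z) - circ y (circ z x))
      + (circ z (circ y x) - circ x (circ z y)).
Proof.
move=> [bil lsym _] x y z; rewrite /commutator_bracket.
rewrite (bilinear_opBl _ _ _ bil) (bilinear_opBr _ _ _ bil) lsym opprB.
by rewrite [X in _ + X = _]addrC addrACA [X in _ + X = _]addrC.
Qed.

Lemma novikov_commutator_lie (K : fieldType) (L : lmodType K)
    (circ : L -> L -> L) :
  is_novikov_algebra circ -> is_lie_algebra (commutator_bracket circ).
Proof.
move=> nov; split; first exact: commutator_bilinear (novikov_bilinear nov).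
  by move=> x; rewrite /commutator_bracket subrr.
move=> x y z; rewrite !(novikov_commutatorE _ _ _ nov).
(* Gathering the first and the second halves of the three summands gives two
   sums of the form (a - b) + (b - c) + (c - a). *)
by rewrite (addrACA (_ - _) _ (_ - _)) [LHS]addrACA !subrKA !subrr addr0.
Qed.

Theorem theorem3p2 (K : fieldType) (charK0 : [pchar K]%R =i pred0)
    (L : lmodType K) (mul circ : L -> L -> L) :
  is_novikov_poisson_algebra mul circ ->
  is_transposed_poisson_algebra mul (commutator_bracket circ).
Proof.
move=> [mulA nov mul_circ compat]; split=> //.
  exact: novikov_commutator_lie.
have mulBr := bilinear_opBr _ _ _ (comm_assoc_bilinear mulA).
have mulC := comm_assoc_comm mulA.
move=> x y z; rewrite scaler_nat mulr2n /commutator_bracket !mul_circ.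
by rewrite [X in _ = _ + X]addrC addrACA [X in _ = _ + X]addrC
  (mulC z y) (mulC z x) -compat !(mulC _ z)
  mulBr.
Qed.
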